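(* Let $X$ and $Y$ be Banach spaces, let $(S,T)\in RP(X,Y)$ be a regular Fredholm pair, and let $(X_1,X_2,\tilde X;Y_1,Y_2,\tilde Y)$ be an adapted decomposition system of $(S,T)$ with its associated subspaces. Suppose that the number of $(S,T)$ is greater than or equal to $2$, and consider the corresponding decompositions $$X=[X_1\oplus(N^2\oplus\mathbb N^1)]\oplus[X_2^2\oplus\mathbb X_2^1]\oplus[\tilde X_N\oplus\tilde X_2],$$ $$Y=[Y_1\oplus(M^2\oplus\mathbb M^1)]\oplus[Y_2^2\oplus\mathbb Y_2^1]\oplus[\tilde Y_N\oplus\tilde Y_2].$$ Then $$\mathrm{ind}(S,T)=\dim(X_1\oplus N^2)-\dim(Y_1\oplus\tilde Y_2)=\dim(X_1\oplus\tilde X_2)-\dim(Y_1\oplus M^2).$$ In addition, if the number of $(S,T)$ is $1$, then $$\mathrm{ind}(S,T)=\dim X_1-\dim Y_1.$$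
   Context: $L(X,Y)$ is the space of bounded linear operators from $X$ to $Y$; $N(\cdot)$ and $R(\cdot)$ denote null space and range; $\mathbb N=\{1,2,\dots\}$, $\mathbb N_0=\mathbb N\cup\{0\}$. Regular Fredholm pairs and index. For $S\in L(X,Y)$, $T\in L(Y,X)$, $(S,T)$ is a Fredholm pair if the numbers $a=\dim N(S)/(N(S)\cap R(T))$, $b=\dim R(T)/(N(S)\cap R(T))$, $c=\dim N(T)/(N(T)\cap R(S))$, $d=\dim R(S)/(N(T)\cap R(S))$ are all finite; its index is $\mathrm{ind}(S,T)=a-b-c+d$. An operator $T\in L(Y,X)$ is regular if $T=TT'T$ for some $T'\in L(X,Y)$. $RP(X,Y)$ is the set of Fredholm pairs $(S,T)$ with both $S$ and $T$ regular. Number. Put $R_{S,0}=Y$, $R_{T,0}=X$, $R_{S,n+1}=S(R_{T,n})$, $R_{T,n+1}=T(R_{S,n})$ for $n\in\mathbb N_0$. These are decreasing sequences of subspaces, finite dimensional for $n\ge 2$. Let $p$ (resp. $q$) be the smallest element of $\mathbb N$ with $R_{S,p}=R_{S,p+k}$ (resp. $R_{T,q}=R_{T,q+k}$) for all $k\ge 0$. The number of $(S,T)$ is $\min\{p,q\}$. Decomposition systems. A decomposition system of $(S,T)\in RP(X,Y)$ consists of finite dimensional subspaces $X_1,X_2\subseteq X$, $Y_1,Y_2\subseteq Y$ and closed subspaces $\tilde X\subseteq X$, $\tilde Y\subseteq Y$ with $N(S)=(N(S)\cap R(T))\oplus X_1$, $R(T)=(N(S)\cap R(T))\oplus X_2$,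 $X=((N(S)\cap R(T))\oplus X_1\oplus X_2)\oplus\tilde X$, $N(T)=(N(T)\cap R(S))\oplus Y_1$, $R(S)=(N(T)\cap R(S))\oplus Y_2$, $Y=((N(T)\cap R(S))\oplus Y_1\oplus Y_2)\oplus\tilde Y$. With it are associated, for $n\in\mathbb N$: $M^n=R_{S,n}\cap N(T)$, $N^n=R_{T,n}\cap N(S)$, $Y_2^n=R_{S,n}\cap Y_2$, $X_2^n=R_{T,n}\cap X_2$; $R_{\tilde S,1}=S(\tilde X)$, $R_{\tilde T,1}=T(\tilde Y)$, $R_{\tilde S,n+1}=S(R_{\tilde T,n})$, $R_{\tilde T,n+1}=T(R_{\tilde S,n})$; $\mathbb M^n=R_{\tilde S,n}\cap N(T)$, $\mathbb N^n=R_{\tilde T,n}\cap N(S)$, $\mathbb Y_2^n=R_{\tilde S,n}\cap Y_2^n$, $\mathbb X_2^n=R_{\tilde T,n}\cap X_2^n$ (here $\mathbb N^n$ is a subspace of $X$, not a power of the natural numbers); $\tilde X_N=\{x\in\tilde X: Sx\in\mathbb M^1\}$, $\tilde X_2=\{x\in\tilde X: Sx\in\mathbb Y_2^1\}$, $\tilde Y_N=\{y\in\tilde Y: Ty\in\mathbb N^1\}$, $\tilde Y_2=\{y\in\tilde Y: Ty\in\mathbb X_2^1\}$. The system is called adapted if for all $n\in\mathbb N$: $R_{S,n}=M^n\oplus Y_2^n$, $R_{T,n}=N^n\oplus X_2^n$, $R_{\tilde S,n}=\mathbb M^n\oplus\mathbb Y_2^n$, $R_{\tilde T,n}=\mathbb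 N^n\oplus\mathbb X_2^n$, $R_{S,n}=R_{S,n+1}\oplus R_{\tilde S,n}$, $R_{T,n}=R_{T,n+1}\oplus R_{\tilde T,n}$. *)

(* Defs.v *)
From HB Require Import structures.
From mathcomp Require Import all_boot all_order all_algebra.
From mathcomp Require Import boolp classical_sets functions.
From mathcomp Require Import topology normedtype.

Set Implicit Arguments.
Unset Strict Implicit.
Unset Printing Implicit Defensive.

Import Order.TTheory GRing.Theory Num.Theory.
Import numFieldNormedType.Exports.

Local Open Scope classical_set_scope.
Local Open Scope ring_scope.

(* Banach spaces are [completeNormedModType K]; the scalar field is left as an
   arbitrary [numFieldType], so that both real and complex spaces are covered. *)

Section Subspaces.
Variables (K : numFieldType) (V : lmodType K).
Implicit Types U W : set V.

Definition linear_subspace U : Prop := submod_closed [in U].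

(* The classes of v 0, ..., v (n - 1) form a basis of the quotient U / W. *)
Definition basis_mod U W n (v : 'I_n -> V) : Prop :=
  (forall i, U (v i)) /\
  (forall u, U u -> exists! c : 'rV[K]_n, W (u - \sum_i c 0 i *: v i)).

Definition has_dim_quot U W n : Prop := exists v : 'I_n -> V, basis_mod U W v.

Definition finite_dim_quot U W : Prop := exists n, has_dim_quot U W n.

(* Equal to 0 by convention when U / W is infinite dimensional. *)
Definition dim_quot U W : nat := xget 0%N [set n | has_dim_quot U W n].

Definition finite_dim U : Prop := finite_dim_quot U [set 0].

Definition sdim U : nat := dim_quot U [set 0].

Fixpoint sumsp (s : seq (set V)) : set V :=
  if s is U :: s' then [set u + w | u in U & w in sumsp s'] else [set 0].

Fixpoint independent (s : seq (set V)) : Prop :=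
  if s is U :: s' then U `&` sumsp s' = [set 0] /\ independent s' else True.

(* U is the internal direct sum of the subspaces listed in s. *)
Definition direct_sum U (s : seq (set V)) : Prop :=
  U = sumsp s /\ independent s.

Definition stable_from (A : nat -> set V) p : Prop :=
  forall k, A p = A (p + k)%N.

(* The smallest p >= 1 from which the sequence A is constant (0 if none). *)
Definition stab_index (A : nat -> set V) : nat :=
  xget 0%N [set p | [/\ (0 < p)%N, stable_from A p &
    forall m, (0 < m)%N -> stable_from A m -> (p <= m)%N]].

End Subspaces.

Section Operators.
Variables (K : numFieldType) (X Y : completeNormedModType K).

Definition nullsp (f : {linear X -> Y}) : set X := f @^-1` [set 0].

(* See [linear_boundedP] for the equivalent form |f x| <= r * |x|. *)
Definition bounded_op (f : {linear X -> Y}) : Prop :=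
  bounded_near f (nbhs (0 : X)).

End Operators.

Definition regular_op (K : numFieldType) (X Y : completeNormedModType K)
    (f : {linear X -> Y}) : Prop :=
  exists g : {linear Y -> X}, bounded_op g /\ forall x, f x = f (g (f x)).

(* The images obtained by applying f and g alternately, the last one being f,
   starting from A or B according to the parity of n. *)
Fixpoint alt_range (X Y : Type) (f : X -> Y) (g : Y -> X)
    (A : set X) (B : set Y) (n : nat) {struct n} : set Y :=
  if n is m.+1 then f @` alt_range g f B A m else B.

Section FredholmPairs.
Variables (K : numFieldType) (X Y : completeNormedModType K).
Variables (S : {linear X -> Y}) (T : {linear Y -> X}).

Definition NS_RT : set X := nullsp S `&` range T.
Definition NT_RS : set Y := nullsp T `&` range S.

Definition fredholm_pair : Prop :=
  [/\ finite_dim_quot (nullsp S) NS_RT, finite_dim_quot (range T) NS_RT,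
      finite_dim_quot (nullsp T) NT_RS & finite_dim_quot (range S) NT_RS].

Definition ind : int :=
  (dim_quot (nullsp S) NS_RT)%:Z - (dim_quot (range T) NS_RT)%:Z
  - (dim_quot (nullsp T) NT_RS)%:Z + (dim_quot (range S) NT_RS)%:Z.

Definition RP : Prop :=
  [/\ bounded_op S, bounded_op T, fredholm_pair, regular_op S & regular_op T].

Definition R_S (n : nat) : set Y := alt_range S T setT setT n.
Definition R_T (n : nat) : set X := alt_range T S setT setT n.

Definition pair_number : nat := minn (stab_index R_S) (stab_index R_T).

End FredholmPairs.

Record sixtuple (K : numFieldType) (X Y : completeNormedModType K) := Sixtuple {
  X_1 : set X; X_2 : set X; X_t : set X;
  Y_1 : set Y; Y_2 : set Y; Y_t : set Y }.

Section DecompositionSystems.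
Variables (K : numFieldType) (X Y : completeNormedModType K).
Variables (S : {linear X -> Y}) (T : {linear Y -> X}) (D : sixtuple X Y).

Record decomposition_system : Prop := DecompositionSystem {
  subspace_X_1 : linear_subspace (X_1 D);
  subspace_X_2 : linear_subspace (X_2 D);
  subspace_X_t : linear_subspace (X_t D);
  subspace_Y_1 : linear_subspace (Y_1 D);
  subspace_Y_2 : linear_subspace (Y_2 D);
  subspace_Y_t : linear_subspace (Y_t D);
  finite_dim_X_1 : finite_dim (X_1 D);
  finite_dim_X_2 : finite_dim (X_2 D);
  finite_dim_Y_1 : finite_dim (Y_1 D);
  finite_dim_Y_2 : finite_dim (Y_2 D);
  closed_X_t : closed (X_t D);
  closed_Y_t : closed (Y_t D);
  decomp_NS : direct_sum (nullsp S) [:: NS_RT S T; X_1 D];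
  decomp_RT : direct_sum (range T) [:: NS_RT S T; X_2 D];
  decomp_X : direct_sum setT [:: NS_RT S T; X_1 D; X_2 D; X_t D];
  decomp_NT : direct_sum (nullsp T) [:: NT_RS S T; Y_1 D];
  decomp_RS : direct_sum (range S) [:: NT_RS S T; Y_2 D];
  decomp_Y : direct_sum setT [:: NT_RS S T; Y_1 D; Y_2 D; Y_t D] }.

Definition R_tS (n : nat) : set Y := alt_range S T (X_t D) (Y_t D) n.
Definition R_tT (n : nat) : set X := alt_range T S (Y_t D) (X_t D) n.

Definition M_ (n : nat) : set Y := R_S S T n `&` nullsp T.
Definition N_ (n : nat) : set X := R_T S T n `&` nullsp S.
Definition Y_2_ (n : nat) : set Y := R_S S T n `&` Y_2 D.
Definition X_2_ (n : nat) : set X := R_T S T n `&` X_2 D.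

(* The prefix bb stands for the blackboard letters. *)
Definition bbM (n : nat) : set Y := R_tS n `&` nullsp T.
Definition bbN (n : nat) : set X := R_tT n `&` nullsp S.
Definition bbY_2 (n : nat) : set Y := R_tS n `&` Y_2_ n.
Definition bbX_2 (n : nat) : set X := R_tT n `&` X_2_ n.

Definition X_tN : set X := X_t D `&` S @^-1` bbM 1.
Definition X_t2 : set X := X_t D `&` S @^-1` bbY_2 1.
Definition Y_tN : set Y := Y_t D `&` T @^-1` bbN 1.
Definition Y_t2 : set Y := Y_t D `&` T @^-1` bbX_2 1.

Definition adapted : Prop := forall n : nat, (0 < n)%N ->
  [/\ direct_sum (R_S S T n) [:: M_ n; Y_2_ n],
      direct_sum (R_T S T n) [:: N_ n; X_2_ n],
      direct_sum (R_tS n) [:: bbM n; bbY_2 n] &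
      direct_sum (R_tT n) [:: bbN n; bbX_2 n]] /\
  direct_sum (R_S S T n) [:: R_S S T n.+1; R_tS n] /\
  direct_sum (R_T S T n) [:: R_T S T n.+1; R_tT n].

End DecompositionSystems.

(* Main.v *)
Require Import Defs.
From HB Require Import structures.
From mathcomp Require Import all_boot all_order all_algebra.
From mathcomp Require Import boolp classical_sets functions.
From mathcomp Require Import topology normedtype.
From mathcomp Require Import zify.

Set Implicit Arguments.
Unset Strict Implicit.
Unset Printing Implicit Defensive.

Import Order.TTheory GRing.Theory Num.Theory.
Import numFieldNormedType.Exports.

Local Open Scope classical_set_scope.
Local Open Scope ring_scope.

(** Write [NS = N(S) & R(T)].  Since [N(S)] is the sum of [NS] and [X_1 D], the
    map [S] is injective on the sum of [X_2 D] and [X_t D]; and [S] kills the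
    part [NS] of [R(T) = NS + X_2 D].  Everything follows from these two facts
    and their mirror images under the exchange of [(S, X)] with [(T, Y)], which
    turns a decomposition system into a decomposition system ([swap]).

    Decompositions.  The adapted system splits [R(T)] once as [NS + X_2 D] and
    once as [R_T 2 + R_tT 1], where each of [R_T 2] and [R_tT 1] is the sum of a
    part in [NS] and a part in [X_2 D].  Comparing the two splittings
    ([direct_sum_refine]) gives [NS = N_ 2 + bbN 1] and
    [X_2 D = X_2_ 2 + bbX_2 1].  The image of [X_t D] under [S] is
    [bbM 1 + bbY_2 1], which pulls back to [X_t D = X_tN + X_t2].  Substituting
    the three refinements in [X = NS + X_1 D + X_2 D + X_t D] yields
    [direct_sum_whole].

    Index.  The complements [X_1 D], [X_2 D], [Y_1 D] and [Y_2 D] model the four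
    quotients, so [ind S T = dim X_1 - dim X_2 - dim Y_1 + dim Y_2]
    ([ind_sdim]).  Moreover
    - [dim X_2 = dim (M_ 2) + dim (Y_2_ 2)], because [S] maps [X_2 D]
      isomorphically onto [R_S 2] ([sdim_X_2_M_2]);
    - [dim X_2 = dim (X_2_ 2) + dim (bbX_2 1)] ([sdim_X_2_bbX_2]);
    - [dim X_t2 = dim (bbY_2 1)], again through [S] ([sdim_X_t2]).
    Together with the mirror identities this gives
    [dim Y_2 - dim X_2 = dim (N_ 2) - dim Y_t2 = dim X_t2 - dim (M_ 2)], hence
    both formulas.

    If the number of the pair is 1, one of the two sequences of ranges is
    stationary from its first term, which forces [dim X_2 = dim Y_2]
    ([sdim_stable]). *)

(** * Subspaces and their finite sums *)

Section SubspaceTheory.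
Variables (K : numFieldType) (V : lmodType K).
Implicit Types (U W A B : set V) (s : seq (set V)).

Lemma linear_subspaceP U :
  linear_subspace U <->
  U 0 /\ forall a u v, U u -> U v -> U (a *: u + v).
Proof.
split=> [[U0 UP]|[U0 UP]].
  split=> [|a u v Uu Uv]; first by move: U0; rewrite inE.
  by have := UP a u v; rewrite !inE; apply.
by split=> [|a u v]; rewrite !inE //; apply: UP.
Qed.

Section Closure.
Variables (U : set V) (subU : linear_subspace U).

Lemma subspace0 : U 0.
Proof. by case/linear_subspaceP: subU. Qed.

Lemma subspaceZD a u v : U u -> U v -> U (a *: u + v).
Proof. by case/linear_subspaceP: subU => _; apply. Qed.

Lemma subspaceD u v : U u -> U v -> U (u + v).
Proof. by move=> Uu Uv; rewrite -[u]scale1r; apply: subspaceZD. Qed.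

Lemma subspaceZ a u : U u -> U (a *: u).
Proof.
by move=> Uu; rewrite -[_ *: _]addr0; apply: subspaceZD => //; apply: subspace0.
Qed.

Lemma subspaceN u : U u -> U (- u).
Proof. by rewrite -scaleN1r; apply: subspaceZ. Qed.

Lemma subspaceB u v : U u -> U v -> U (u - v).
Proof. by move=> Uu Uv; apply: subspaceD => //; apply: subspaceN. Qed.

Lemma subspace_sum (I : Type) (r : seq I) (F : I -> V) :
  (forall i, U (F i)) -> U (\sum_(i <- r) F i).
Proof.
by move=> UF; elim/big_ind: _ => //; [apply: subspace0 | apply: subspaceD].
Qed.

End Closure.

Lemma subspaceT : linear_subspace [set: V].
Proof. by apply/linear_subspaceP. Qed.

Lemma subspaceI U W :
  linear_subspace U -> linear_subspace W -> linear_subspace (U `&` W).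
Proof.
move=> subU subW; apply/linear_subspaceP; split.
  by split; apply: subspace0.
by move=> a u v [? ?] [? ?]; split; apply: subspaceZD.
Qed.

Lemma subspace_sumsp s : {in s, forall U, linear_subspace U} ->
  linear_subspace (sumsp s).
Proof.
elim: s => [_|U s IHs subs] /=.
  apply/linear_subspaceP; split=> // a u v -> ->.
  by rewrite scaler0 addr0.
have subU : linear_subspace U by apply: subs; rewrite mem_head.
have {IHs} subS : linear_subspace (sumsp s).
  by apply: IHs => W sW; apply: subs; rewrite inE sW orbT.
apply/linear_subspaceP; split.
  exists 0; first exact: subspace0.
  by exists 0; [apply: subspace0 | rewrite addr0].
move=> a _ _ [u Uu [w Ww <-]] [u' Uu' [w' Ww' <-]].
exists (a *: u + u'); first exact: subspaceZD.
exists (a *: w + w'); first exact: subspaceZD.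
by rewrite scalerDr addrACA.
Qed.

Lemma sumsp_consP U s x :
  sumsp (U :: s) x <-> exists u w, [/\ U u, sumsp s w & x = u + w].
Proof.
split=> [[u Uu [w sw <-]]|[u [w [Uu sw ->]]]]; first by exists u, w.
by exists u => //; exists w.
Qed.

Lemma sumsp2P A B x :
  sumsp [:: A; B] x <-> exists a b, [/\ A a, B b & x = a + b].
Proof.
split=> [[a Aa [_ [b Bb [_ -> <-]]] <-]|[a [b [Aa Bb ->]]]].
  by exists a, b; rewrite addr0.
by exists a => //; exists b => //; exists b => //; exists 0; rewrite ?addr0.
Qed.

Local Arguments sumsp : simpl never.

Lemma sumsp1 U : sumsp [:: U] = U.
Proof.
rewrite predeqE => x; split=> [[u Uu [_ -> <-]]|Ux]; first by rewrite addr0.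
by exists x => //; exists 0; rewrite ?addr0.
Qed.

Lemma sumsp_cat s1 s2 : sumsp (s1 ++ s2) = sumsp [:: sumsp s1; sumsp s2].
Proof.
elim: s1 => [|U s IHs] /=; rewrite predeqE => x.
  split=> [sx|/sumsp2P[_ [b [-> Bb ->]]]]; last by rewrite add0r.
  by apply/sumsp2P; exists 0, x; rewrite add0r.
split=> [/sumsp_consP[u [w [Uu]]]|].
  rewrite IHs => /sumsp2P[a [b [sa sb ->]]] ->; apply/sumsp2P.
  exists (u + a), b; split; rewrite ?addrA //.
  by apply/sumsp_consP; exists u, a.
move=> /sumsp2P[a [b [/sumsp_consP[u [w [Uu sw ->]]] sb ->]]].
apply/sumsp_consP; exists u, (w + b); rewrite addrA; split=> //.
by rewrite IHs; apply/sumsp2P; exists w, b.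
Qed.

Lemma subspace_cons U s : {in U :: s, forall W, linear_subspace W} ->
  linear_subspace U /\ {in s, forall W, linear_subspace W}.
Proof.
move=> subs; split=> [|W sW]; apply: subs; first exact: mem_head.
by rewrite inE sW orbT.
Qed.

Lemma sumsp_mask m s : {in s, forall U, linear_subspace U} ->
  sumsp (mask m s) `<=` sumsp s.
Proof.
elim: s m => [|U s IHs] [|b m] //= subs x //.
  move=> ->; apply: (subspace0 (subspace_sumsp subs)).
have [subU /IHs{}IHs] := subspace_cons subs.
case: b => [/sumsp_consP[u [w [Uu /IHs sw ->]]]|/IHs sx]; apply/sumsp_consP.
  by exists u, w.
by exists 0, x; rewrite add0r; split=> //; apply: subspace0.
Qed.

Lemma trivIP A B : linear_subspace A -> linear_subspace B ->
  A `&` B = [set 0] <-> forall x, A x -> B x -> x = 0.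
Proof.
move=> subA subB; split=> [AB0 x Ax Bx|AB0].
  by have : [set 0] x by rewrite -AB0.
rewrite predeqE => x; split=> [[/AB0 AB /AB //]|->].
by split; apply: subspace0.
Qed.

Lemma subspaces_nil : {in [::], forall W, linear_subspace W}.
Proof. by []. Qed.

Lemma subspaces_cons U s : linear_subspace U ->
  {in s, forall W, linear_subspace W} ->
  {in U :: s, forall W, linear_subspace W}.
Proof. by move=> subU subs W /predU1P[->|/subs]. Qed.

Lemma subspace_catl s1 s2 : {in s1 ++ s2, forall W, linear_subspace W} ->
  {in s1, forall W, linear_subspace W}.
Proof. by move=> subs W sW; apply: subs; rewrite mem_cat sW. Qed.

Lemma subspace_catr s1 s2 : {in s1 ++ s2, forall W, linear_subspace W} ->
  {in s2, forall W, linear_subspace W}.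
Proof. by move=> subs W sW; apply: subs; rewrite mem_cat sW orbT. Qed.

Lemma independent_mask m s : {in s, forall U, linear_subspace U} ->
  independent s -> independent (mask m s).
Proof.
elim: s m => [|U s IHs] [|b m] //= /subspace_cons[subU subs].
have subm : linear_subspace (sumsp (mask m s)).
  by apply: subspace_sumsp => W /mem_mask; apply: subs.
move=> [/(trivIP subU (subspace_sumsp subs)) Us0 ind_s].
case: b => /=; last exact: IHs.
split; last exact: IHs.
by apply/trivIP => // x Ux /(sumsp_mask subs) sx; apply: Us0.
Qed.

Lemma independent_cat s1 s2 : {in s1 ++ s2, forall U, linear_subspace U} ->
  independent (s1 ++ s2) <->
  [/\ independent s1, independent s2 & sumsp s1 `&` sumsp s2 = [set 0]].
Proof.
elim: s1 => [|U s IHs] subs.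
  have sub0 : linear_subspace (sumsp (V := V) [::]) by apply: subspace_sumsp.
  split=> [ind2|[]//]; split=> //.
  by apply/(trivIP sub0 (subspace_sumsp subs)) => x ->.
have subUS := subspace_sumsp (subspace_catl subs).
have [subU subc] := subspace_cons subs; have {}IHs := IHs subc.
have subS := subspace_sumsp (subspace_catl subc).
have subS2 := subspace_sumsp (subspace_catr subc).
have subC := subspace_sumsp subc.
split=> [[/(trivIP subU subC) UC0 /IHs[ind1 ind2 /(trivIP subS subS2) S0]]|].
  split=> //.
    split=> //; apply/(trivIP subU subS) => x Ux sx; apply: UC0 => //.
    rewrite sumsp_cat; apply/sumsp2P.
    by exists x, 0; split; rewrite ?addr0 //; apply: subspace0.
  apply/(trivIP subUS subS2) => x /sumsp_consP[u [w [Uu sw ->]]] s2uw.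
  have u0 : u = 0.
    apply: UC0 => //; rewrite sumsp_cat; apply/sumsp2P.
    exists (- w), (u + w); split=> //; first exact: subspaceN.
    by rewrite addrC addrK.
  by move: s2uw; rewrite u0 add0r => s2w; apply: S0.
move=> [[/(trivIP subU subS) U0 ind1] ind2 /(trivIP subUS subS2) S0].
split.
  apply/(trivIP subU subC) => u Uu.
  rewrite sumsp_cat => /sumsp2P[a [b [sa sb def_u]]].
  have b0 : b = 0.
    apply: S0 => //; apply/sumsp_consP; exists u, (- a).
    by split=> //; [exact: subspaceN | rewrite def_u addrC addKr].
  by apply: U0 => //; rewrite def_u b0 addr0.
apply/IHs; split=> //; apply/(trivIP subS subS2) => x sx; apply: S0.
by apply/sumsp_consP; exists 0, x; rewrite add0r; split=> //; apply: subspace0.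
Qed.

(** A decomposition may be refined block by block, the lists in [ss] being
    decompositions of the successive summands. *)
Lemma direct_sum_flatten U (ss : seq (seq (set V))) :
  {in flatten ss, forall W, linear_subspace W} ->
  {in ss, forall s, independent s} -> direct_sum U (map (@sumsp K V) ss) ->
  direct_sum U (flatten ss).
Proof.
move=> subs ind_ss [-> ind_map].
suff [ind_fl eq_fl] : independent (flatten ss) /\
    sumsp (flatten ss) = sumsp (map (@sumsp K V) ss).
  by split.
elim: ss subs ind_ss ind_map => [|s ss IHss] //= subs ind_ss [s0 ind_map].
have [] // := IHss (subspace_catr subs) _ ind_map.
  by move=> t sst; apply: ind_ss; rewrite inE sst orbT.
move=> ind_fl eq_fl; split.
  apply/independent_cat => //; split=> //; last by rewrite eq_fl.
  by apply: ind_ss; rewrite mem_head.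
rewrite sumsp_cat eq_fl predeqE => x.
by split=> [/sumsp2P[a [b H]]|/sumsp_consP[a [b H]]];
   [apply/sumsp_consP | apply/sumsp2P]; exists a, b.
Qed.

Lemma direct_sum2P U A B : linear_subspace A -> linear_subspace B ->
  direct_sum U [:: A; B] <->
  [/\ forall a b, A a -> B b -> U (a + b),
      forall u, U u -> exists a b, [/\ A a, B b & u = a + b]
    & forall x, A x -> B x -> x = 0].
Proof.
move=> subA subB; rewrite /direct_sum /independent sumsp1.
have sub0 : linear_subspace (sumsp (V := V) [::]) by apply: subspace_sumsp.
have B0 : B `&` sumsp [::] = [set 0] by apply/trivIP.
split=> [[-> [/(trivIP subA subB) AB0 _]]|[AU UAB AB0]].
  by split=> [a b Aa Bb|u /sumsp2P//|//]; apply/sumsp2P; exists a, b.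
split; last by split=> //; apply/trivIP.
rewrite predeqE => x; split=> [/UAB/sumsp2P //|].
by move=> /sumsp2P[a [b [Aa Bb ->]]]; apply: AU.
Qed.

(** Exchanging the first two summands leaves their common sum unchanged, and
    with it the condition on the remaining ones. *)
Lemma direct_sum_swap W A B s : {in A :: B :: s, forall U, linear_subspace U} ->
  direct_sum W [:: A, B & s] -> direct_sum W [:: B, A & s].
Proof.
move=> subs [-> ind_s].
have subBA : {in [:: B; A] ++ s, forall U, linear_subspace U}.
  by move=> U; rewrite !inE orbCA => sU; apply: subs; rewrite !inE.
have subAB : {in [:: A; B] ++ s, forall U, linear_subspace U} := subs.
have eqAB : sumsp [:: A; B] = sumsp [:: B; A].
  by rewrite predeqE => x; split=> /sumsp2P[a [b [? ? ->]]]; apply/sumsp2P;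
     exists b, a; rewrite addrC.
split.
  rewrite -[LHS]/(sumsp ([:: A; B] ++ s)) -[RHS]/(sumsp ([:: B; A] ++ s)).
  by rewrite !sumsp_cat eqAB.
have sub0 : linear_subspace (sumsp (V := V) [::]) by apply: subspace_sumsp.
have subA : linear_subspace A by case/subspace_cons: subs.
apply/(independent_cat subBA).
case/(independent_cat subAB): ind_s => -[AB0 _] ind_s ABs0.
split=> //; last by rewrite -eqAB.
split; first by rewrite sumsp1 setIC -[B]sumsp1.
by split=> //; apply/trivIP.
Qed.

(** When the summands of a second decomposition of [U] lie in those of the
    first, matching components term by term shows that they refine it. *)
Lemma direct_sum_refine U A B P Q A1 A2 B1 B2 :
  {in [:: A; B; A1; A2; B1; B2; P; Q], forall W, linear_subspace W} ->
  direct_sum U [:: A; B] -> direct_sum U [:: P; Q] ->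
  direct_sum P [:: A1; B1] -> direct_sum Q [:: A2; B2] ->
  A1 `<=` A -> A2 `<=` A -> B1 `<=` B -> B2 `<=` B ->
  direct_sum A [:: A1; A2].
Proof.
move=> /subspace_cons[sA] /subspace_cons[sB] /subspace_cons[sA1].
move=> /subspace_cons[sA2] /subspace_cons[sB1] /subspace_cons[sB2].
move=> /subspace_cons[sP] /subspace_cons[sQ _].
move=> /(direct_sum2P _ sA sB)[ABU _ AB0] /(direct_sum2P _ sP sQ)[_ UPQ PQ0].
move=> /(direct_sum2P _ sA1 sB1)[AB1P PAB1 _].
move=> /(direct_sum2P _ sA2 sB2)[AB2Q QAB2 _] A1A A2A B1B B2B.
apply/direct_sum2P => //; split=> [a1 a2 /A1A Aa1 /A2A Aa2|a Aa|x A1x A2x].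
- exact: subspaceD.
- have [_ [_ [/PAB1[a1 [b1 [Aa1 Bb1 ->]]] /QAB2[a2 [b2 [Aa2 Bb2 ->]]] def_a]]] :
    exists p q, [/\ P p, Q q & a = p + q].
    by apply: UPQ; rewrite -[a]addr0; apply: ABU => //; apply: subspace0.
  exists a1, a2; split=> //; apply/eqP; rewrite -subr_eq0; apply/eqP/AB0.
    by apply: subspaceB => //; apply: subspaceD; [|apply: A1A | apply: A2A].
  rewrite def_a addrACA [_ - _]addrC addKr.
  by apply: subspaceD => //; [apply: B1B | apply: B2B].
- apply: PQ0; rewrite -[x]addr0; [apply: AB1P | apply: AB2Q] => //;
  exact: subspace0.
Qed.

End SubspaceTheory.

(** * Dimension *)

Local Notation has_dim U n := (has_dim_quot U [set 0] n).

Section Dimension.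
Variables (K : numFieldType) (V : lmodType K).
Implicit Types (U W A B : set V).

Lemma lincombP n (v : 'I_n -> V) :
  exists g : {linear 'rV[K]_n -> V}, forall c, g c = \sum_i c 0 i *: v i.
Proof.
pose g (c : 'rV[K]_n) := \sum_i c 0 i *: v i.
have lin_g : linear g.
  move=> a c d; rewrite /g scaler_sumr -big_split /=; apply: eq_bigr => i _.
  by rewrite !mxE scalerDl scalerA.
pose G : {linear 'rV[K]_n -> V} :=
  HB.pack_for {linear 'rV[K]_n -> V} g (GRing.isLinear.Build _ _ _ _ g lin_g).
by exists G.
Qed.

(** A basis is the same as a linear parametrization by coordinate vectors;
    bases are handled through these below. *)
Lemma has_dimP U n : linear_subspace U ->
  has_dim U n <->
  exists g : {linear 'rV[K]_n -> V}, injective g /\ U = range g.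
Proof.
move=> subU; split=> [[v [Uv vU]]|[g [inj_g ->]]].
  have [g gE] := lincombP v; exists g.
  have Ug c : U (g c).
    by rewrite gE; apply: subspace_sum => // i; apply: subspaceZ.
  split=> [c d eq_cd|].
    have [e [_ e_uniq]] := vU _ (Ug c).
    by rewrite -(e_uniq c) ?(e_uniq d) // -gE ?eq_cd /= ?subrr.
  rewrite predeqE => u; split=> [/vU[c [/eqP]]|[c _ <-]//].
  by rewrite subr_eq0 -gE => /eqP -> _; exists c.
exists (fun i => g (delta_mx 0 i)); split=> [i|_ [c _ <-]].
  by exists (delta_mx 0 i).
have gE (d : 'rV[K]_n) : \sum_i d 0 i *: g (delta_mx 0 i) = g d.
  rewrite [in RHS](row_sum_delta d) linear_sum.
  by apply: eq_bigr => i _; rewrite linearZ.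
exists c; split; first by rewrite gE subrr.
by move=> d; rewrite gE => /eqP; rewrite subr_eq0 => /eqP /inj_g.
Qed.

(** The coordinates along [h] of the vectors [g (delta_mx 0 i)] are the rows of
    a matrix whose row kernel is that of [g], hence zero. *)
Lemma inj_range_leq m n (g : {linear 'rV[K]_m -> V})
    (h : {linear 'rV[K]_n -> V}) :
  injective g -> range g `<=` range h -> (m <= n)%N.
Proof.
move=> inj_g gh.
have /choice[r hr] : forall i, exists x, h x = g (delta_mx 0 i).
  move=> i; have [|x _] := gh (g (delta_mx 0 i)); last by exists x.
  by exists (delta_mx 0 i).
pose A := \matrix_i r i.
have hA x : h (x *m A) = g x.
  rewrite mulmx_sum_row [in RHS](row_sum_delta x) !linear_sum.
  by apply: eq_bigr => i _; rewrite !linearZ /= rowK hr.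
suff : row_free A by move/eqP <-; exact: rank_leq_col.
apply: inj_row_free => x xA0; apply: inj_g.
by rewrite -hA xA0 !linear0.
Qed.

Lemma has_dim_inj U m n :
  linear_subspace U -> has_dim U m -> has_dim U n -> m = n.
Proof.
move=> subU /(has_dimP _ subU)[g [inj_g eqUg]].
move=> /(has_dimP _ subU)[h [inj_h eqUh]].
have eq_gh : range g = range h by rewrite -eqUg.
apply/eqP; rewrite eqn_leq (@inj_range_leq _ _ g h) ?eq_gh //.
by rewrite (@inj_range_leq _ _ h g) ?eq_gh.
Qed.

(** A largest independent family in [U] is a basis of [U]; its size is bounded
    by [inj_range_leq].  As [h] need not be injective, this covers both the
    subspaces and the linear images of a finite dimensional space. *)
Lemma has_dim_sub U n (h : {linear 'rV[K]_n -> V}) :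
  linear_subspace U -> U `<=` range h -> exists2 m, (m <= n)%N & has_dim U m.
Proof.
move=> subU Uh.
(* The rows of A are the coordinates of a family of size k. *)
pose P k := `[< exists A : 'M[K]_(k, n),
  injective (fun x : 'rV_k => h (x *m A)) /\
  forall x : 'rV_k, U (h (x *m A)) >].
have exP : exists k, P k.
  exists 0%N; apply/asboolP; exists 0; split=> [x y _|x].
    by apply/rowP=> -[].
  by rewrite mulmx0 linear0; apply: subspace0.
have ubP k : P k -> (k <= n)%N.
  move=> /asboolP[A [inj_A _]].
  apply: (@inj_range_leq _ _ (h \o mulmxr A) h) => // _ [x _ <-].
  by exists (x *m A).
case: (ex_maxnP exP ubP) => m Pm max_m; exists m; first exact: ubP.
have /asboolP[A [inj_A UA]] := Pm.
apply/has_dimP => //; exists (h \o mulmxr A); split=> //.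
rewrite predeqE => u; split=> [Uu|[x _ <-]]; last exact: UA.
apply: contrapT => Au.
have [y _ hy] := Uh _ Uu.
(* Otherwise [u = h y] could be added to the family. *)
suff : P (m + 1)%N by move/max_m; rewrite addn1 ltnn.
have hAy (x : 'rV_(m + 1)) : h (x *m col_mx A y) =
    h (lsubmx x *m A) + rsubmx x 0 0 *: u.
  rewrite -[x in LHS]hsubmxK mul_row_col linearD [rsubmx x]mx11_scalar.
  by rewrite mul_scalar_mx linearZ /= hy -mx11_scalar.
apply/asboolP; exists (col_mx A y); split=> [|x]; last first.
  by rewrite hAy addrC; apply: subspaceZD.
pose hA : {linear 'rV_(m + 1) -> V} := h \o mulmxr (col_mx A y).
suff ker0 x : hA x = 0 -> x = 0.
  move=> x z eq_xz; apply/eqP; rewrite -subr_eq0; apply/eqP/ker0.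
  by rewrite linearB /= eq_xz subrr.
rewrite /= hAy; set a := rsubmx x 0 0; have [a0|nz_a] := eqVneq a 0.
  rewrite a0 scale0r addr0 -[0](linear0 (h \o mulmxr A)) => /inj_A l0.
  by rewrite -[x]hsubmxK l0 [rsubmx x]mx11_scalar -/a a0 raddf0 row_mx0.
move=> /eqP; rewrite addrC addr_eq0 => /eqP eq_au; case: Au.
exists (- a^-1 *: lsubmx x) => //=.
rewrite -scalemxAl linearZ /= scaleNr -scalerN -eq_au scalerA mulVf //.
by rewrite scale1r.
Qed.

Lemma sdimE U n : linear_subspace U -> has_dim U n -> sdim U = n.
Proof.
move=> subU dimU; rewrite /sdim /dim_quot.
by apply: xget_unique => // m /= dimUm; apply: (has_dim_inj subU).
Qed.

Lemma has_dim_sdim U : finite_dim U -> has_dim U (sdim U).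
Proof. exact: (@xgetPex _ 0%N). Qed.

Lemma sdim_sub U W : linear_subspace U -> linear_subspace W ->
  finite_dim W -> U `<=` W ->
  finite_dim U /\ (sdim U <= sdim W)%N.
Proof.
move=> subU subW /has_dim_sdim/(has_dimP _ subW)[h [_ eqW]] UW.
have [|m le_m dimU] := @has_dim_sub U _ h subU; first by rewrite -eqW.
by split; [exists m | rewrite (sdimE subU dimU)].
Qed.

Lemma sdim_direct_sum U A B : linear_subspace A -> linear_subspace B ->
  finite_dim A -> finite_dim B -> direct_sum U [:: A; B] ->
  finite_dim U /\ sdim U = (sdim A + sdim B)%N.
Proof.
move=> subA subB /has_dim_sdim/(has_dimP _ subA)[g [inj_g eqA]].
move=> /has_dim_sdim/(has_dimP _ subB)[h [inj_h eqB]].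
have subAB : linear_subspace (sumsp [:: A; B]).
  by apply: subspace_sumsp => W; rewrite !inE => /orP[]/eqP->.
move: (sdim A) (sdim B) g inj_g eqA h inj_h eqB => m n g inj_g eqA h inj_h eqB.
move=> [-> [AB0 _]].
suff dimU : has_dim (sumsp [:: A; B]) (m + n).
  by split; [exists (m + n)%N | exact: sdimE].
rewrite sumsp1 in AB0.
have [f fE] : exists f : {linear 'rV[K]_(m + n) -> V},
    forall x, f x = g (lsubmx x) + h (rsubmx x).
  by exists ((g \o lsubmx) \+ (h \o rsubmx)).
apply/has_dimP => //; exists f; split.
  suff ker0 x : f x = 0 -> x = 0.
    move=> x z eq_xz; apply/eqP; rewrite -subr_eq0; apply/eqP/ker0.
    by rewrite linearB /= eq_xz subrr.
  rewrite fE => /eqP; rewrite addr_eq0 => /eqP eq_gh.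
  have gx0 : g (lsubmx x) = 0.
    suff : (A `&` B) (g (lsubmx x)) by rewrite AB0.
    split; first by rewrite eqA; exists (lsubmx x).
    by rewrite eqB eq_gh -linearN; exists (- rsubmx x).
  have hx0 : h (rsubmx x) = 0 by apply: oppr_inj; rewrite -eq_gh gx0 oppr0.
  rewrite -[x]hsubmxK.
  have -> : lsubmx x = 0 by apply: inj_g; rewrite linear0.
  have -> : rsubmx x = 0 by apply: inj_h; rewrite linear0.
  by rewrite row_mx0.
rewrite predeqE => u; split=> [/sumsp2P[a [b []]]|[x _ <-]].
  rewrite eqA eqB => -[x _ <-] [y _ <-] ->.
  by exists (row_mx x y); rewrite // fE row_mxKl row_mxKr.
apply/sumsp2P; exists (g (lsubmx x)), (h (rsubmx x)).
by rewrite eqA eqB fE.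
Qed.

(** A complement of [W] in [U] is a model of [U / W]: replacing the members of
    a basis modulo [W] by their components in the complement gives a basis of
    the complement. *)
Lemma dim_quot_direct_sum U W A : linear_subspace W -> linear_subspace A ->
  direct_sum U [:: W; A] -> dim_quot U W = sdim A.
Proof.
move=> subW subA /(direct_sum2P _ subW subA)[WAU UWA WA0].
rewrite /sdim /dim_quot; congr (xget _ _); rewrite predeqE => n /=.
suff main : forall v w : 'I_n -> V,
    (forall i, A (v i)) -> (forall i, W (w i)) ->
    basis_mod U W (v \+ w) <-> basis_mod A [set 0] v.
  split=> -[v vP]; last first.
    exists (v \+ (fun=> 0)); apply/main => //; first by case: vP.
    by move=> _; apply: subspace0.
  have /choice[a aP] : forall i, exists a, A a /\ W (v i - a).
    move=> i; have [w [a [Ww Aa ->]]] := UWA _ (vP.1 i).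
    by exists a; rewrite addrK.
  have Aa i : A (a i) by case: (aP i).
  have Wva i : W (v i - a i) by case: (aP i).
  exists a; apply: (iffLR (main a (fun i => v i - a i) Aa Wva)).
  congr (basis_mod U W _): vP; apply/funext=> i /=.
  by rewrite addrC subrK.
move=> v w Av Ww.
have sumA (c : 'rV[K]_n) : A (\sum_i c 0 i *: v i).
  by apply: subspace_sum => // i; apply: subspaceZ.
have sumW (c : 'rV[K]_n) : W (\sum_i c 0 i *: w i).
  by apply: subspace_sum => // i; apply: subspaceZ.
have modW a (c : 'rV[K]_n) x : W x -> A a ->
    W (x + a - \sum_i c 0 i *: (v \+ w) i) <-> a - \sum_i c 0 i *: v i = 0.
  move=> Wx Aa.
  have -> : x + a - \sum_i c 0 i *: (v \+ w) i =
     (x - \sum_i c 0 i *: w i) + (a - \sum_i c 0 i *: v i).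
    rewrite addrACA -opprD [_ + \sum_i _]addrC -big_split /=.
    by congr (_ - _); apply: eq_bigr => i _; rewrite scalerDr.
  split=> [Wxa|->]; last by rewrite addr0; apply: subspaceB.
  apply: WA0; last exact: subspaceB.
  rewrite -[X in W X](addKr (x - \sum_i c 0 i *: w i)) addrC.
  by apply: subspaceB => //; apply: subspaceB.
split=> -[Uv vU]; split=> //.
- move=> a Aa; have [|c [cP c_uniq]] := vU a.
    by rewrite -[a]add0r; apply: WAU => //; apply: subspace0.
  have modWa d := @modW a d 0 (subspace0 subW) Aa; rewrite add0r in modWa.
  exists c; split; first exact/modWa.
  by move=> d /= /modWa /c_uniq.
- by move=> i; rewrite /= addrC; apply: WAU.
move=> _ /UWA[x [a [Wx Aa ->]]]; have [c [cP c_uniq]] := vU a Aa.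
exists c; split; first exact/modW.
by move=> d /(modW a d x Wx Aa) /c_uniq.
Qed.

End Dimension.

Section Image.
Variables (K : numFieldType) (V W : lmodType K) (f : {linear V -> W}).

Lemma subspace_image (U : set V) :
  linear_subspace U -> linear_subspace (f @` U).
Proof.
move=> subU; apply/linear_subspaceP; split.
  by exists 0; rewrite ?linear0 //; apply: subspace0.
move=> a _ _ [u Uu <-] [v Uv <-]; exists (a *: u + v); last by rewrite linearP.
exact: subspaceZD.
Qed.

Lemma subspace_preimage (U : set W) :
  linear_subspace U -> linear_subspace (f @^-1` U).
Proof.
move=> subU; apply/linear_subspaceP; split=> [|a u v Uu Uv] /=.
  by rewrite linear0; apply: subspace0.
by rewrite linearP; apply: subspaceZD.
Qed.

Lemma sdim_image (U : set V) : linear_subspace U -> finite_dim U ->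
  finite_dim (f @` U) /\ (sdim (f @` U) <= sdim U)%N.
Proof.
move=> subU /has_dim_sdim/(has_dimP _ subU)[g [_ eqU]].
have [|m le_m dimfU] :=
    @has_dim_sub _ _ (f @` U) _ (f \o g) (subspace_image subU).
  by rewrite [X in f @` X]eqU => _ [_ [x _ <-] <-]; exists x.
by split; [exists m | rewrite (sdimE (subspace_image subU) dimfU)].
Qed.

(** A linear relation between the images of vectors of [U] already holds between
    the vectors, so bases correspond in both directions. *)
Lemma has_dim_image_inj (U : set V) n : linear_subspace U ->
  (forall u, U u -> f u = 0 -> u = 0) -> has_dim (f @` U) n <-> has_dim U n.
Proof.
move=> subU inj_f.
suff main : forall v : 'I_n -> V, (forall i, U (v i)) ->
    basis_mod U [set 0] v <-> basis_mod (f @` U) [set 0] (f \o v).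
  split=> -[v vP]; last first.
    by exists (f \o v); apply/main => //; case: vP.
  have /choice[u uP] : forall i, exists u, U u /\ f u = v i.
    by move=> i; have [u Uu fu] := vP.1 i; exists u.
  exists u; apply/main => [i|]; first by case: (uP i).
  by congr (basis_mod _ _ _): vP; apply/funext=> i /=; case: (uP i).
move=> v Uv.
have fP u (c : 'rV[K]_n) : U u ->
    f u - \sum_i c 0 i *: (f \o v) i = 0 <-> u - \sum_i c 0 i *: v i = 0.
  move=> Uu.
  have -> : f u - \sum_i c 0 i *: (f \o v) i = f (u - \sum_i c 0 i *: v i).
    rewrite linearB (linear_sum f) /=.
    by under [in RHS]eq_bigr => i _ do rewrite linearZ.
  split=> [|->]; last by rewrite linear0.
  apply: inj_f; apply: subspaceB => //.
  by apply: subspace_sum => // i; apply: subspaceZ.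
split=> -[_ vU]; split=> //.
- by move=> i; exists (v i).
- move=> _ [u Uu <-]; have [c [cP c_uniq]] := vU u Uu.
  by exists c; split=> [|d /(fP u d Uu) /c_uniq//]; apply/fP.
- move=> u Uu; have [|c [cP c_uniq]] := vU (f u); first by exists u.
  by exists c; split=> [|d /(fP u d Uu) /c_uniq//]; apply/fP.
Qed.

End Image.

(** * Adapted decomposition systems *)

Lemma subspace_alt_range (K : numFieldType) (X Y : lmodType K)
    (f : {linear X -> Y}) (g : {linear Y -> X}) (A : set X) (B : set Y) n :
  linear_subspace A -> linear_subspace B ->
  linear_subspace (alt_range f g A B n).
Proof.
elim: n X Y f g A B => [|n IHn] X Y f g A B subA subB //=.
by apply: subspace_image; apply: IHn.
Qed.

Section Swap.
Variables (K : numFieldType) (X Y : completeNormedModType K).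

(** Since the iterated ranges, the null spaces and the associated subspaces are
    defined symmetrically, those of [(T, S)] and [swap D] are convertible to
    the mirror ones of [(S, T)] and [D]. *)
Definition swap (D : sixtuple X Y) : sixtuple Y X :=
  Sixtuple (Y_1 D) (Y_2 D) (Y_t D) (X_1 D) (X_2 D) (X_t D).

Lemma decomposition_system_swap (S : {linear X -> Y}) (T : {linear Y -> X}) D :
  decomposition_system S T D -> decomposition_system T S (swap D).
Proof. by case. Qed.

Lemma adapted_swap (S : {linear X -> Y}) (T : {linear Y -> X}) D :
  adapted S T D -> adapted T S (swap D).
Proof. by move=> adD n /adD[[? ? ? ?] [? ?]]. Qed.

End Swap.

Section Adapted.
Variables (K : numFieldType) (X Y : completeNormedModType K).
Variables (S : {linear X -> Y}) (T : {linear Y -> X}) (D : sixtuple X Y).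
Hypotheses (sysD : decomposition_system S T D) (adD : adapted S T D).

Let subX1 := subspace_X_1 sysD.
Let subX2 := subspace_X_2 sysD.
Let subXt := subspace_X_t sysD.
Let subY2 := subspace_Y_2 sysD.
Let subYt := subspace_Y_t sysD.

Let sub_nullS : linear_subspace (nullsp S).
Proof.
apply: subspace_preimage; apply/linear_subspaceP; split=> // a _ _ -> ->.
by rewrite scaler0 addr0.
Qed.

Let sub_nullT : linear_subspace (nullsp T).
Proof.
apply: subspace_preimage; apply/linear_subspaceP; split=> // a _ _ -> ->.
by rewrite scaler0 addr0.
Qed.

Let sub_R_S n : linear_subspace (R_S S T n).
Proof. by apply: subspace_alt_range; apply: subspaceT. Qed.

Let sub_R_T n : linear_subspace (R_T S T n).
Proof. by apply: subspace_alt_range; apply: subspaceT. Qed.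

Let sub_R_tS n : linear_subspace (R_tS S T D n).
Proof. exact: subspace_alt_range. Qed.

Let sub_R_tT n : linear_subspace (R_tT S T D n).
Proof. exact: subspace_alt_range. Qed.

Let sub_NS_RT : linear_subspace (NS_RT S T).
Proof. by apply: subspaceI => //; apply/subspace_image/subspaceT. Qed.

Let sub_NT_RS : linear_subspace (NT_RS S T).
Proof. by apply: subspaceI => //; apply/subspace_image/subspaceT. Qed.

Let sub_M n : linear_subspace (M_ S T n).
Proof. exact: subspaceI. Qed.

Let sub_N n : linear_subspace (N_ S T n).
Proof. exact: subspaceI. Qed.

Let sub_Y_2_ n : linear_subspace (Y_2_ S T D n).
Proof. exact: subspaceI. Qed.

Let sub_X_2_ n : linear_subspace (X_2_ S T D n).
Proof. exact: subspaceI. Qed.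

Let sub_bbM n : linear_subspace (bbM S T D n).
Proof. exact: subspaceI. Qed.

Let sub_bbN n : linear_subspace (bbN S T D n).
Proof. exact: subspaceI. Qed.

Let sub_bbY_2 n : linear_subspace (bbY_2 S T D n).
Proof. exact: subspaceI. Qed.

Let sub_bbX_2 n : linear_subspace (bbX_2 S T D n).
Proof. exact: subspaceI. Qed.

Let sub_X_tN : linear_subspace (X_tN S T D).
Proof. by apply: subspaceI => //; apply: subspace_preimage. Qed.

Let sub_X_t2 : linear_subspace (X_t2 S T D).
Proof. by apply: subspaceI => //; apply: subspace_preimage. Qed.

(** [X_2 D] and [X_t D] together span a complement of the null space of [S]. *)
Let inj_S x : sumsp [:: X_2 D; X_t D] x -> S x = 0 -> x = 0.
Proof.
have subs : {in [:: NS_RT S T; X_1 D] ++ [:: X_2 D; X_t D],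
    forall U, linear_subspace U}.
  by do 4!apply: subspaces_cons => //; apply: subspaces_nil.
have [_ /(independent_cat subs)[_ _ nullS0]] := decomp_X sysD.
have [eq_nullS _] := decomp_NS sysD; rewrite -eq_nullS in nullS0.
by move=> sx Sx0; have : [set 0] x by rewrite -nullS0.
Qed.

Let inj_S_X2 x : X_2 D x -> S x = 0 -> x = 0.
Proof.
move=> X2x; apply: inj_S; apply/sumsp2P; exists x, 0.
by rewrite addr0; split=> //; apply: subspace0.
Qed.

Let inj_S_Xt x : X_t D x -> S x = 0 -> x = 0.
Proof.
move=> Xtx; apply: inj_S; apply/sumsp2P; exists 0, x.
by rewrite add0r; split=> //; apply: subspace0.
Qed.

Let R_T2_sub : R_T S T 2 `<=` range T.
Proof. by move=> _ [y _ <-]; exists y. Qed.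

Let R_tT1_sub : R_tT S T D 1 `<=` range T.
Proof. by move=> _ [y _ <-]; exists y. Qed.

Let refine_subs : {in [:: NS_RT S T; X_2 D; N_ S T 2; bbN S T D 1;
    X_2_ S T D 2; bbX_2 S T D 1; R_T S T 2; R_tT S T D 1],
  forall U, linear_subspace U}.
Proof. by do 8!apply: subspaces_cons => //; apply: subspaces_nil. Qed.

(** Both [R_T 2] and [R_tT 1] lie in the range of [T], so that their parts in
    the null space of [S] lie in [NS_RT S T]. *)
Lemma direct_sum_NS_RT : direct_sum (NS_RT S T) [:: N_ S T 2; bbN S T D 1].
Proof.
have [[_ _ _ dec_R_tT1] [_ dec_R_T1]] := adD (ltn0Sn 0).
have [[_ dec_R_T2 _ _] _] := adD (ltn0Sn 1).
apply: (direct_sum_refine refine_subs (decomp_RT sysD) dec_R_T1) => //.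
- by move=> x [/R_T2_sub ? ?].
- by move=> x [/R_tT1_sub ? ?].
- by move=> x [].
- by move=> x [_ []].
Qed.

Lemma direct_sum_X_2 : direct_sum (X_2 D) [:: X_2_ S T D 2; bbX_2 S T D 1].
Proof.
have swap2 U A B : linear_subspace A -> linear_subspace B ->
    direct_sum U [:: A; B] -> direct_sum U [:: B; A].
  move=> subA subB; apply: direct_sum_swap.
  by do 2!apply: subspaces_cons => //; apply: subspaces_nil.
have [[_ _ _ dec_R_tT1] [_ dec_R_T1]] := adD (ltn0Sn 0).
have [[_ dec_R_T2 _ _] _] := adD (ltn0Sn 1).
apply: (@direct_sum_refine _ _ (range T) _ (NS_RT S T) _ _ _ _ (N_ S T 2)
  (bbN S T D 1) _ _ dec_R_T1) => //.
- by do 8!apply: subspaces_cons => //; apply: subspaces_nil.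
- by apply: swap2 => //; apply: decomp_RT sysD.
- exact: swap2.
- exact: swap2.
- by move=> x [].
- by move=> x [_ []].
- by move=> x [/R_T2_sub ? ?].
- by move=> x [/R_tT1_sub ? ?].
Qed.

(** The splitting of [S @` X_t D] pulls back, [S] being injective there. *)
Lemma direct_sum_X_t : direct_sum (X_t D) [:: X_tN S T D; X_t2 S T D].
Proof.
have [[_ _ /(direct_sum2P _ (sub_bbM 1) (sub_bbY_2 1))[_ decSt SMY0] _] _] :=
  adD (ltn0Sn 0).
apply/direct_sum2P => //; split=> [a b [Xta _] [Xtb _]|x Xtx|x [Xtx Mx] [_ Yx]].
- exact: subspaceD.
- have [m [y [Mm Yy Sx]]] : exists m y,
    [/\ bbM S T D 1 m, bbY_2 S T D 1 y & S x = m + y].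
    by apply: decSt; exists x.
  have [[a Xta def_m] _] := Mm; have [[b Xtb def_y] _] := Yy.
  rewrite -def_m in Mm Sx; rewrite -def_y in Yy Sx.
  exists a, b; split=> //; apply/eqP; rewrite -subr_eq0; apply/eqP/inj_S_Xt.
    by apply: subspaceB => //; apply: subspaceD.
  by rewrite linearB linearD Sx subrr.
- by apply: inj_S_Xt => //; apply: SMY0.
Qed.

Let whole_subs : {in [:: X_1 D; N_ S T 2; bbN S T D 1; X_2_ S T D 2;
    bbX_2 S T D 1; X_tN S T D; X_t2 S T D], forall U, linear_subspace U}.
Proof. by do 7!apply: subspaces_cons => //; apply: subspaces_nil. Qed.

Lemma direct_sum_whole : direct_sum [set: X]
  [:: X_1 D; N_ S T 2; bbN S T D 1; X_2_ S T D 2; bbX_2 S T D 1;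
      X_tN S T D; X_t2 S T D].
Proof.
have [defN indN] := direct_sum_NS_RT; have [def2 ind2] := direct_sum_X_2.
have [deft indt] := direct_sum_X_t.
apply: (@direct_sum_flatten _ _ _ [:: [:: X_1 D]; [:: N_ S T 2; bbN S T D 1];
  [:: X_2_ S T D 2; bbX_2 S T D 1]; [:: X_tN S T D; X_t2 S T D]]) => //.
  move=> s; rewrite !inE => /or4P[]/eqP-> //; split=> //.
  have sub0 : linear_subspace (sumsp (V := X) [::]) by apply: subspace_sumsp.
  by apply/(trivIP subX1 sub0).
rewrite !map_cons sumsp1 -defN -def2 -deft.
apply: direct_sum_swap (decomp_X sysD).
by do 4!apply: subspaces_cons => //; apply: subspaces_nil.
Qed.

Lemma sdim_X_1_N_2 : finite_dim (N_ S T 2) ->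
  finite_dim (sumsp [:: X_1 D; N_ S T 2]) /\
  sdim (sumsp [:: X_1 D; N_ S T 2]) = (sdim (X_1 D) + sdim (N_ S T 2))%N.
Proof.
move=> finN; apply: sdim_direct_sum => //; first exact: finite_dim_X_1 sysD.
split=> //.
exact: (independent_mask [:: true; true] whole_subs direct_sum_whole.2).
Qed.

Lemma sdim_X_1_X_t2 : finite_dim (X_t2 S T D) ->
  finite_dim (sumsp [:: X_1 D; X_t2 S T D]) /\
  sdim (sumsp [:: X_1 D; X_t2 S T D]) = (sdim (X_1 D) + sdim (X_t2 S T D))%N.
Proof.
move=> finX; apply: sdim_direct_sum => //; first exact: finite_dim_X_1 sysD.
split=> //.
(* The mask selects the first and the last of the seven summands. *)
pose ends := true :: rcons (nseq 5 false) true.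
exact: (independent_mask ends whole_subs direct_sum_whole.2).
Qed.

(** [S] kills [NS_RT S T] and is injective on [X_2 D], so that the second
    iterate is a copy of [X_2 D]. *)
Lemma sdim_R_S2 : finite_dim (R_S S T 2) /\ sdim (R_S S T 2) = sdim (X_2 D).
Proof.
have eqR : R_S S T 2 = S @` X_2 D.
  rewrite predeqE => y; split=> [[x Rx <-]|[x X2x <-]].
    have [_ decRT _] := iffLR (direct_sum2P _ sub_NS_RT subX2) (decomp_RT sysD).
    have [u [v [[Su0 _] X2v ->]]] := decRT x Rx.
    by exists v; rewrite // linearD /= Su0 add0r.
  have [decRT _ _] := iffLR (direct_sum2P _ sub_NS_RT subX2) (decomp_RT sysD).
  by exists x => //; rewrite -[x]add0r; apply: decRT => //; apply: subspace0.
have dimR : has_dim (R_S S T 2) (sdim (X_2 D)).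
  rewrite eqR; apply/has_dim_image_inj => //.
  exact/has_dim_sdim/(finite_dim_X_2 sysD).
by split; [exists (sdim (X_2 D)) | apply: sdimE].
Qed.

Lemma sdim_X_2_M_2 : finite_dim (M_ S T 2) /\
  sdim (X_2 D) = (sdim (M_ S T 2) + sdim (Y_2_ S T D 2))%N.
Proof.
have [finR <-] := sdim_R_S2.
have sub_part U : linear_subspace U -> U `<=` R_S S T 2 -> finite_dim U.
  by move=> subU UR; have [] := sdim_sub subU (sub_R_S 2) finR UR.
have finM : finite_dim (M_ S T 2) by apply: sub_part => // x [].
have finY : finite_dim (Y_2_ S T D 2) by apply: sub_part => // x [].
split=> //; have [[decR _ _ _] _] := adD (ltn0Sn 1).
by have [] := sdim_direct_sum _ _ finM finY decR.
Qed.

Lemma sdim_X_2_bbX_2 :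
  sdim (X_2 D) = (sdim (X_2_ S T D 2) + sdim (bbX_2 S T D 1))%N.
Proof.
have sub_part U : linear_subspace U -> U `<=` X_2 D -> finite_dim U.
  by move=> subU UX; have [] := sdim_sub subU subX2 (finite_dim_X_2 sysD) UX.
have [] // := sdim_direct_sum _ _ _ _ direct_sum_X_2; apply: sub_part => //.
  by move=> x [].
by move=> x [_ []].
Qed.

(** [bbY_2 1] lies in the image of [X_t D], so [S] maps [X_t2] onto it. *)
Lemma sdim_X_t2 :
  finite_dim (X_t2 S T D) /\ sdim (X_t2 S T D) = sdim (bbY_2 S T D 1).
Proof.
have eqY : S @` X_t2 S T D = bbY_2 S T D 1.
  rewrite predeqE => y; split=> [[x [_ Yx] <-]//|Yy].
  by have [[x Xtx def_y] _] := Yy; exists x => //; split=> //=; rewrite def_y.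
have finY : finite_dim (bbY_2 S T D 1).
  have [] // := sdim_sub (sub_bbY_2 1) subY2 (finite_dim_Y_2 sysD).
  by move=> y [_ []].
have dimX : has_dim (X_t2 S T D) (sdim (bbY_2 S T D 1)).
  apply/(@has_dim_image_inj _ _ _ S) => //.
    by move=> x [Xtx _]; apply: inj_S_Xt.
  by rewrite eqY; apply: has_dim_sdim.
by split; [exists (sdim (bbY_2 S T D 1)) | apply: sdimE].
Qed.

Lemma dim_quot_NS_RT :
  dim_quot (nullsp S) (NS_RT S T) = sdim (X_1 D) /\
  dim_quot (range T) (NS_RT S T) = sdim (X_2 D).
Proof.
split; apply: dim_quot_direct_sum => //; first exact: decomp_NS sysD.
exact: decomp_RT sysD.
Qed.

(** If [R_S] is stationary from the first step, then [Y_2 D] lies in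
    [R_S 2 = R_S 3], the image under [S] of [R_T 2], whose dimension is that of
    [Y_2 D]: thus [R_S 2], a copy of [X_2 D], has the dimension of [Y_2 D]. *)
Lemma sdim_stable : finite_dim (R_T S T 2) -> sdim (R_T S T 2) = sdim (Y_2 D) ->
  stable_from (R_S S T) 1 -> sdim (X_2 D) = sdim (Y_2 D).
Proof.
move=> finRT dimRT stab; have [finR dimR] := sdim_R_S2.
apply/eqP; rewrite -dimR eqn_leq; apply/andP; split; last first.
  have [] // := sdim_sub subY2 (sub_R_S 2) finR.
  rewrite -(stab 1%N) => y Y2y.
  have [decRS _ _] := iffLR (direct_sum2P _ sub_NT_RS subY2) (decomp_RS sysD).
  by rewrite -[y]add0r; apply: decRS => //; apply: subspace0.
rewrite -dimRT -(stab 1%N) (stab 2%N).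
by have [] := sdim_image S (sub_R_T 2) finRT.
Qed.

End Adapted.

Lemma ind_sdim (K : numFieldType) (X Y : completeNormedModType K)
    (S : {linear X -> Y}) (T : {linear Y -> X}) (D : sixtuple X Y) :
  decomposition_system S T D ->
  ind S T = (sdim (X_1 D))%:Z - (sdim (X_2 D))%:Z
            - (sdim (Y_1 D))%:Z + (sdim (Y_2 D))%:Z.
Proof.
move=> sysD; have [eqa eqb] := dim_quot_NS_RT sysD.
have [eqc eqd] := dim_quot_NS_RT (decomposition_system_swap sysD).
by rewrite /ind eqa eqb -[NT_RS S T]/(NS_RT T S) eqc eqd.
Qed.

(** The default value 0 of [stab_index] differs from 1. *)
Lemma stab_index1 (K : numFieldType) (V : lmodType K) (A : nat -> set V) :
  stab_index A = 1%N -> stable_from A 1.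
Proof.
rewrite /stab_index; case: xgetP => // _ -> [_ stabA _] eq1.
by rewrite eq1 in stabA.
Qed.

Theorem theorem4p1 (K : numFieldType) (X Y : completeNormedModType K)
    (S : {linear X -> Y}) (T : {linear Y -> X}) (D : sixtuple X Y)
    (regST : RP S T) (sysD : decomposition_system S T D)
    (adD : adapted S T D) :
  ((2 <= pair_number S T)%N ->
    (* the decompositions of X and Y *)
    [/\ direct_sum [set: X]
          [:: X_1 D; N_ S T 2; bbN S T D 1;
              X_2_ S T D 2; bbX_2 S T D 1;
              X_tN S T D; X_t2 S T D] &
        direct_sum [set: Y]
          [:: Y_1 D; M_ S T 2; bbM S T D 1;
              Y_2_ S T D 2; bbY_2 S T D 1;
              Y_tN S T D; Y_t2 S T D]] /\
    (* the dimensions below are finite *)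
    [/\ finite_dim (sumsp [:: X_1 D; N_ S T 2]),
        finite_dim (sumsp [:: Y_1 D; Y_t2 S T D]),
        finite_dim (sumsp [:: X_1 D; X_t2 S T D]) &
        finite_dim (sumsp [:: Y_1 D; M_ S T 2])] /\
    (* the index formulas *)
    ind S T = (sdim (sumsp [:: X_1 D; N_ S T 2]))%:Z
              - (sdim (sumsp [:: Y_1 D; Y_t2 S T D]))%:Z /\
    ind S T = (sdim (sumsp [:: X_1 D; X_t2 S T D]))%:Z
              - (sdim (sumsp [:: Y_1 D; M_ S T 2]))%:Z) /\
  (pair_number S T = 1%N ->
    ind S T = (sdim (X_1 D))%:Z - (sdim (Y_1 D))%:Z).
Proof.
have sysD' := decomposition_system_swap sysD; have adD' := adapted_swap adD.
rewrite (ind_sdim sysD); split=> [_|number1].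
  have [finM dimX2] := sdim_X_2_M_2 sysD adD.
  have [finN dimY2] := sdim_X_2_M_2 sysD' adD'.
  have [finXt dimXt] := sdim_X_t2 sysD.
  have [finYt dimYt] := sdim_X_t2 sysD'.
  have dimX2' := sdim_X_2_bbX_2 sysD adD.
  have dimY2' := sdim_X_2_bbX_2 sysD' adD'.
  have [finXN dimXN] := sdim_X_1_N_2 sysD adD finN.
  have [finYM dimYM] := sdim_X_1_N_2 sysD' adD' finM.
  have [finXX dimXX] := sdim_X_1_X_t2 sysD adD finXt.
  have [finYY dimYY] := sdim_X_1_X_t2 sysD' adD' finYt.
  split.
    by split; [apply: direct_sum_whole | apply: (direct_sum_whole sysD' adD')].
  split; first by split.
  move: dimX2 dimY2 dimXt dimYt dimX2' dimY2' dimXN dimYM dimXX dimYY => /=.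
  rewrite -[M_ T S]/(N_ S T) -[N_ T S]/(M_ S T).
  rewrite -[X_t2 T S (swap D)]/(Y_t2 S T D) -[bbY_2 T S (swap D)]/(bbX_2 S T D).
  rewrite -[bbX_2 T S (swap D)]/(bbY_2 S T D).
  rewrite -[X_2_ T S (swap D)]/(Y_2_ S T D) -[Y_2_ T S (swap D)]/(X_2_ S T D).
  by move=> + + + + + + -> -> -> ->; lia.
have [[finRS dimRS] [finRT dimRT]] := (sdim_R_S2 sysD, sdim_R_S2 sysD').
suff -> : sdim (X_2 D) = sdim (Y_2 D) by lia.
have [/stab_index1 stabS|/stab_index1 stabT] :
    stab_index (R_S S T) = 1%N \/ stab_index (R_T S T) = 1%N.
  by move: number1; rewrite /pair_number; lia.
  exact: sdim_stable stabS.
by symmetry; apply: (sdim_stable sysD').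
Qed.
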